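(* Let $n\ge 3$ be an integer and $\alpha>0$ a real number such that $$\frac{1}{n}\sum_{j=1}^{n-1}\csc^{\alpha}\frac{j\pi}{n}\leq 1+\frac{\alpha}{4}.$$ Then the regular $n$-gon with equal masses is the unique centered co-circular central configuration of $n$ positive masses for the power-law potential $U_\alpha$. That is: let $m_1,\dots,m_n>0$ and let $x_1,\dots,x_n$ be pairwise distinct points lying on a common circle whose center is the center of mass $c_0=\frac{\sum_k m_kx_k}{\sum_k m_k}$. Then $(x_1,\dots,x_n)$ is a central configuration for the masses $(m_1,\dots,m_n)$ and the potential $U_\alpha$ if and only if $m_1=\dots=m_n$ and $x_1,\dots,x_n$ are (in some order) the vertices of a regular $n$-gon.
   Context: For $\alpha>0$, masses $m_1,\dots,m_n>0$ and pairwise distinct points $x_1,\dots,x_n\in\mathbb{R}^3$, the power-law potential is $U_\alpha(x)=\sum_{1\le j<k\le n}\frac{m_jm_k}{|x_j-x_k|^\alpha}$. The configuration $(x_1,\dots,x_n)$ is a central configuration for the masses $(m_1,\dots,m_n)$ if there is a constant $\lambda\in\mathbb{R}$ such that $$\sum_{j\ne k}\frac{x_j-x_k}{|x_j-x_k|^{\alpha+2}}m_jm_k=-\frac{\lambda}{\alpha}m_k(x_k-c_0),\qquad k=1,\dots,n,$$ where $c_0=\frac{\sum_{k}m_kx_k}{\sum_k m_k}$ is the center of mass. A central configuration is centered co-circular if all the points lie on a circle (of positive radius, in a plane) whose center is $c_0$. Central configurations are considered modulo rotations, translations and dilations. *)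

(* Defs.v *)
From mathcomp Require Import all_boot all_order all_algebra.
From mathcomp Require Import perm.
From mathcomp Require Import reals exp trigo.

Set Implicit Arguments.
Unset Strict Implicit.
Unset Printing Implicit Defensive.
Import Order.TTheory GRing.Theory Num.Theory.
Local Open Scope ring_scope.

Section Configurations.
Context {R : realType}.

Definition csc (t : R) : R := (sin t)^-1.

Definition dot (d : nat) (u v : 'rV[R]_d) : R := \sum_(i < d) u 0 i * v 0 i.

(* The norm `|v| that MathComp-Analysis puts on 'rV[R]_d is the sup norm, so
   the Euclidean norm is defined separately. *)
Definition enorm (d : nat) (v : 'rV[R]_d) : R := Num.sqrt (dot v v).

Definition center_of_mass (n : nat) (m : 'I_n -> R) (x : 'I_n -> 'rV[R]_3) :
    'rV[R]_3 :=
  (\sum_k m k)^-1 *: \sum_k m k *: x k.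

Definition central_configuration (alpha : R) (n : nat) (m : 'I_n -> R)
    (x : 'I_n -> 'rV[R]_3) : Prop :=
  exists lambda : R, forall k : 'I_n,
    \sum_(j < n | j != k)
       (m j * m k) *: ((enorm (x j - x k) `^ (alpha + 2))^-1 *: (x j - x k))
    = - (lambda / alpha) *: (m k *: (x k - center_of_mass m x)).

(* The circle of center c and radius r in the plane through c normal to nu;
   it is a genuine circle when 0 < r and nu != 0. *)
Definition on_circle (c nu : 'rV[R]_3) (r : R) (p : 'rV[R]_3) : Prop :=
  enorm (p - c) = r /\ dot (p - c) nu = 0.

Definition centered_cocircular (n : nat) (m : 'I_n -> R)
    (x : 'I_n -> 'rV[R]_3) : Prop :=
  exists (nu : 'rV[R]_3) (r : R),
    [/\ nu != 0, 0 < r & forall k, on_circle (center_of_mass m x) nu r (x k)].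

(* The orthonormal pair (u, v) spans the plane of the polygon and absorbs its
   phase; s is the order in which the points visit the vertices. *)
Definition regular_polygon (n : nat) (x : 'I_n -> 'rV[R]_3) : Prop :=
  exists (c u v : 'rV[R]_3) (r : R) (s : 'S_n),
    [/\ 0 < r, dot u u = 1, dot v v = 1, dot u v = 0 &
     forall k : 'I_n,
       let t := 2 * pi * (s k)%:R / n%:R in
       x k = c + r *: (cos t *: u + sin t *: v)].

End Configurations.

(* Main.v *)
(* Write the points as c + r e^(2 i a_k) with 0 <= a_k < pi.  Being a central
   configuration then splits into a radial part, sum_j m_j |sin(a_j - a_k)|^-alpha
   independent of k, and a tangential part.  Since the circle is centered at the
   center of mass, one may add (alpha/2) sin^2 to |sin|^-alpha: for
     g(t) = |sin t|^-alpha + (alpha/2) sin^2 t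
   the matrix G_jk = g(a_j - a_k) (zero diagonal) satisfies G m = E 1, and a is a
   critical point of m^T G m.  The kernel g has its minimum rho = 1 + alpha/2 at
   pi/2, and g' increases on (0, pi), so such a critical point is a strict global
   minimum among configurations with the same cyclic order, in particular
   compared with the regular polygon, of matrix G' with G' 1 = E' 1.  The
   hypothesis on csc says exactly E' <= n rho, i.e. that 1 is a supersolution for
   G' - rho, whose off-diagonal entries are nonnegative; hence v^T G' v <= 0 when
   sum v = 0.  With mu the mean mass and v = m - mu:
     n mu E = m^T G m <= m^T G' m = n mu^2 E' + v^T G' v, so E <= mu E' <= n mu rho;
   now m is a supersolution for G - rho, so v^T G v <= 0, which amounts to
   mu 1^T G 1 <= n E <= n mu E' = mu 1^T G' 1.  But 1^T G 1 >= 1^T G' 1 by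
   minimality of the polygon for equal masses.  Equality everywhere forces the
   polygon, then v = 0. *)
Require Import Defs.
From mathcomp Require Import all_boot all_order all_algebra.
From mathcomp Require Import perm ring lra.
From mathcomp Require Import boolp functions normedtype derive realfun.
From mathcomp Require Import reals exp trigo.
Set Implicit Arguments.
Unset Strict Implicit.
Unset Printing Implicit Defensive.
Import Order.TTheory GRing.Theory Num.Theory.
Local Open Scope ring_scope.

(** * Convexity of the corrected kernel *)

Section Kernel.
Import numFieldNormedType.Exports.
Context {R : realType} (alpha : R).
Hypothesis alpha_gt0 : 0 < alpha.
Implicit Types s t : R.

(* 0 `^ (- alpha) = 0 for alpha != 0, so the kernel vanishes at its pole and sums
   over all pairs need not exclude the diagonal. *)
Definition kernel t : R := `|sin t| `^ (- alpha) + alpha / 2 * sin t ^+ 2.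

(** The derivative of [kernel] on (0, pi), in a form that is odd, pi-periodic and zero at the
    poles. *)
Definition dkernel t : R :=
  alpha * (sin t * cos t * (1 - `|sin t| `^ (- (alpha + 2)))).

Lemma kernelN t : kernel (- t) = kernel t.
Proof. by rewrite /kernel sinN normrN sqrrN. Qed.

Lemma kernelDpi t : kernel (t + pi) = kernel t.
Proof. by rewrite /kernel sinDpi normrN sqrrN. Qed.

Lemma dkernelN t : dkernel (- t) = - dkernel t.
Proof. by rewrite /dkernel sinN cosN normrN !mulNr mulrN. Qed.

Lemma dkernelDpi t : dkernel (t + pi) = dkernel t.
Proof. by rewrite /dkernel sinDpi cosDpi normrN mulrNN. Qed.

Lemma kernel_pihalf : kernel (pi / 2) = 1 + alpha / 2.
Proof. by rewrite /kernel sin_pihalf normr1 powR1 expr1n mulr1. Qed.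

Lemma dkernel_pihalf : dkernel (pi / 2) = 0.
Proof. by rewrite /dkernel cos_pihalf mulr0 mul0r mulr0. Qed.

(** On (0, pi/2] the opposite of [dkernel], divided by alpha, is cos times (sin^-(alpha+1) - sin): a
    product of two nonnegative decreasing factors. *)
Lemma dkernel_lt_pihalf s t :
  0 < s -> s < t -> t <= pi / 2 -> dkernel s < dkernel t.
Proof.
move=> s0 st th; have pi0 := pi_gt0 R; have a0 := alpha_gt0.
have dE u : 0 < u -> u <= pi / 2 ->
    dkernel u = - (alpha * (cos u * (sin u `^ (- (alpha + 1)) - sin u))).
  move=> u0 uh; have su : 0 < sin u by apply: sin_gt0_pi; lra.
  rewrite /dkernel gtr0_norm//.
  have -> : - (alpha + 1) = - (alpha + 2) + 1 by ring.
  rewrite (@powRD _ _ _ 1); last by rewrite [sin _ == 0]gt_eqF ?implybT.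
  by rewrite powRr1 ?ltW//; ring.
rewrite !dE//; [|lra..]; rewrite ltrN2 ltr_pM2l//.
have ss : 0 < sin s by apply: sin_gt0_pi; lra.
have ssst : sin s < sin t by rewrite ltr_sin ?in_itv/=; lra.
have [ct cs] : 0 <= cos t /\ 0 < cos s.
  by split; [apply: cos_ge0_pihalf|apply: cos_gt0_pihalf]; lra.
have cst : cos t <= cos s by apply: ltW; rewrite ltr_cos ?in_itv/=; lra.
have pw : sin t `^ (- (alpha + 1)) < sin s `^ (- (alpha + 1)).
  rewrite !powRN ltf_pV2 ?posrE ?powR_gt0//; last by rewrite (lt_trans ss).
  by apply: gt0_ltr_powR; rewrite ?nnegrE; lra.
have pt : 1 <= sin t `^ (- (alpha + 1)).
  rewrite -[leLHS](powRr0 (sin t)); apply: ger_powR; last lra.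
  by rewrite sin_le1 (lt_trans ss).
have := sin_le1 t.
move: (sin t `^ _) (sin s `^ _) pw pt => P Q PQ P1 st1.
apply: (@le_lt_trans _ _ (cos s * (P - sin t))).
  by rewrite ler_wpM2r//; lra.
by rewrite ltr_pM2l//; lra.
Qed.

(** The reflection u -> pi - u flips the sign of [dkernel], which carries monotonicity over to the
    second half; across pi/2 the sign changes from negative to positive. *)
Lemma dkernel_lt s t : 0 < s -> s < t -> t < pi -> dkernel s < dkernel t.
Proof.
move=> s0 st tpi; have pi0 := pi_gt0 R.
have refl u : dkernel u = - dkernel (pi - u).
  by rewrite -dkernelN opprB -[in LHS](subrK pi u) dkernelDpi.
have [th|th] := leP t (pi / 2); first exact: dkernel_lt_pihalf.
have neg u : 0 < u -> u < pi / 2 -> dkernel u < 0.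
  by move=> u0 uh; rewrite -dkernel_pihalf dkernel_lt_pihalf.
have t_gt0 : 0 < dkernel t by rewrite refl oppr_gt0 neg; lra.
have [sh|sh] := ltP s (pi / 2).
  by apply: lt_trans t_gt0; rewrite neg.
by rewrite refl [X in _ < X]refl ltrN2 dkernel_lt_pihalf; lra.
Qed.

Lemma is_derive_kernel t : 0 < t < pi ->
  is_derive t 1 (fun u => sin u `^ (- alpha) + alpha / 2 * sin u ^+ 2)
    (dkernel t).
Proof.
move=> /sin_gt0_pi st.
have d1 := is_derive1_comp (is_derive1_powR (- alpha) st) (is_derive_sin t).
have d2 := is_deriveZ (alpha / 2) (is_deriveX 2 (is_derive_sin t)).
set f := (fun u => _); have := is_deriveD d1 d2; set g := (X in is_derive _ _ X _).
have -> : g = f by apply/funext => u; rewrite /g /f !fctE.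
move=> d; apply: (is_derive_eq d).
rewrite /dkernel gtr0_norm// /GRing.scale/=.
have -> : - alpha - 1 = - (alpha + 2) + 1 by ring.
rewrite (@powRD _ _ _ 1); last by rewrite [sin _ == 0]gt_eqF ?implybT.
by rewrite powRr1 ?ltW//; field.
Qed.

(** Strict convexity: by the mean value theorem the increment is governed by an intermediate slope,
    which [dkernel_lt] compares with the slope at [s]. *)
Lemma kernel_tangent_lt s t : 0 < s < pi -> 0 < t < pi -> s != t ->
  kernel s + dkernel s * (t - s) < kernel t.
Proof.
set f := fun u => sin u `^ (- alpha) + alpha / 2 * sin u ^+ 2.
have fE u : 0 < u < pi -> kernel u = f u.
  by move=> /sin_gt0_pi su; rewrite /kernel gtr0_norm.
have mvt a b : 0 < a -> a < b -> b < pi ->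
    exists2 c, a < c < b & f b - f a = dkernel c * (b - a).
  move=> a0 ab bpi.
  have df u : a <= u <= b -> is_derive u 1 f (dkernel u).
    by move=> uab; apply: is_derive_kernel; lra.
  have [||] := @MVT _ f dkernel a b ab.
  - by move=> u; rewrite in_itv/= => uab; apply: df; lra.
  - apply: derivable_within_continuous => u; rewrite in_itv/= => /df.
    by case.
  - by move=> c; rewrite in_itv/= => cab eq; exists c.
move=> s0 t0 nst; rewrite !fE//.
move: nst; rewrite neq_lt => /orP[st|ts].
  have [|||c cst] := mvt s t; [lra..|].
  move=> /eqP; rewrite subr_eq addrC => /eqP ->.
  by rewrite ltrD2l ltr_pM2r ?subr_gt0// dkernel_lt; lra.
have [|||c cst] := mvt t s; [lra..|].
have : dkernel c * (s - t) < dkernel s * (s - t).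
  by rewrite ltr_pM2r ?subr_gt0// dkernel_lt; lra.
move: (dkernel c) (dkernel s) (f s) (f t) => *; lra.
Qed.

(* On (-pi, pi) the kernel is convex on either side of its pole at 0, so the
   tangent inequality holds between arguments of equal sign. *)
Lemma kernel_tangent_sign_lt s t : s != 0 -> t != 0 ->
  (0 < s) = (0 < t) -> `|s| < pi -> `|t| < pi -> s != t ->
  kernel s + dkernel s * (t - s) < kernel t.
Proof.
move=> s0 t0 st; rewrite !ltr_norml => sp tp nst.
have [sgt|sle] := ltP 0 s.
  by apply: kernel_tangent_lt => //; rewrite -?st sgt; lra.
have {sle} slt : s < 0 by rewrite lt_neqAle s0.
have tlt : t < 0 by rewrite lt_neqAle t0 leNgt -st -leNgt ltW.
have := @kernel_tangent_lt (- s) (- t).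
have -> : dkernel s * (t - s) = dkernel (- s) * (- t - - s).
  by rewrite dkernelN; ring.
by rewrite !kernelN eqr_opp; apply => //; lra.
Qed.

(** The tangent at pi/2 is horizontal, at height 1 + alpha/2. *)
Lemma kernel_gt t : t != 0 -> `|t| < pi -> `|t| != pi / 2 ->
  1 + alpha / 2 < kernel t.
Proof.
move=> t0 tp th; have pi0 := pi_gt0 R.
have -> : kernel t = kernel `|t|.
  by have [//|] := ger0P t; rewrite kernelN.
have := @kernel_tangent_lt (pi / 2) `|t|.
rewrite kernel_pihalf dkernel_pihalf mul0r addr0; apply; first lra.
  by rewrite normr_gt0 t0.
by rewrite eq_sym.
Qed.

Lemma kernel_ge t : t != 0 -> `|t| < pi -> 1 + alpha / 2 <= kernel t.
Proof.
move=> t0 tp; have [th|th] := eqVneq `|t| (pi / 2); last first.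
  exact/ltW/kernel_gt.
rewrite -kernel_pihalf -th le_eqVlt; apply/orP; left; apply/eqP.
by have [//|] := ger0P t; rewrite kernelN.
Qed.

End Kernel.

(** * Quadratic forms with a positive supersolution *)

Section QuadraticForms.
Context {R : realFieldType} {I : finType}.
Implicit Types (H : I -> I -> R) (u v w z : I -> R).

Definition quad_form H v : R := \sum_j \sum_k H j k * (v j * v k).

(** Write z_j z_k = (z_j^2 + z_k^2)/2 - (z_j - z_k)^2/2; by symmetry of [H] the two sums of squares
    coincide. *)
Lemma quad_form_scaled H w z : (forall j k, H j k = H k j) ->
  quad_form H (fun j => w j * z j)
    + 2^-1 * \sum_j \sum_k H j k * (w j * w k) * (z j - z k) ^+ 2
  = \sum_j z j ^+ 2 * w j * \sum_k H j k * w k.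
Proof.
move=> symH; set S := RHS.
have SE : S = \sum_j \sum_k H j k * (w j * w k) * z j ^+ 2.
  by apply: eq_bigr => j _; rewrite mulr_sumr; apply: eq_bigr => k _; ring.
have SE' : S = \sum_j \sum_k H j k * (w j * w k) * z k ^+ 2.
  rewrite SE exchange_big; apply: eq_bigr => j _; apply: eq_bigr => k _.
  by rewrite symH; ring.
have -> : S = 2^-1 * (S + S) by field.
rewrite {1}SE SE' -big_split /quad_form.
rewrite !mulr_sumr -big_split; apply: eq_bigr => j _ /=.
rewrite -big_split !mulr_sumr -big_split; apply: eq_bigr => k _ /=.
by field.
Qed.

(* Perron-Frobenius: a symmetric matrix with nonnegative off-diagonal entries
   and a positive supersolution is negative semidefinite. *)
Lemma quad_form_le0 H w v : (forall j k, H j k = H k j) ->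
  (forall j k, j != k -> 0 <= H j k) -> (forall j, 0 < w j) ->
  (forall j, \sum_k H j k * w k <= 0) ->
  quad_form H v <= 0 /\
  (0 <= quad_form H v ->
    forall j k, j != k -> 0 < H j k -> v j / w j = v k / w k).
Proof.
move=> symH H0 w0 Hw; pose z j := v j / w j.
have vE : v =1 (fun j => w j * z j).
  by move=> j; rewrite /z mulrC divfK// gt_eqF.
have qE : quad_form H v = quad_form H (fun j => w j * z j).
  by apply: eq_bigr => j _; apply: eq_bigr => k _; rewrite {1}vE {1}(vE k).
(* Diagonal entries of [H] may be negative, but there [z j - z k] vanishes. *)
have D0 j k : 0 <= H j k * (w j * w k) * (z j - z k) ^+ 2.
  have [->|jk] := eqVneq j k; first by rewrite subrr expr0n mulr0.
  by rewrite mulr_ge0 ?sqr_ge0// mulr_ge0 ?H0// mulr_ge0// ltW.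
have := quad_form_scaled w z symH; rewrite -qE.
set D := (X in _ + 2^-1 * X); set S := RHS => DS.
have S0 : S <= 0.
  apply: sumr_le0 => j _; rewrite mulr_ge0_le0//.
  by rewrite mulr_ge0 ?sqr_ge0// ltW.
have D_ge0 : 0 <= D by apply: sumr_ge0 => j _; apply: sumr_ge0.
split; first by lra.
move=> q0 j k jk Hjk.
have : D = 0 by lra.
move=> /eqP; rewrite psumr_eq0; last by move=> ? _; apply: sumr_ge0.
move=> /allP/(_ j (mem_index_enum _)) /=; rewrite psumr_eq0//.
move=> /allP/(_ k (mem_index_enum _)) /=.
rewrite !mulf_eq0 !(gt_eqF (w0 _)) gt_eqF//= orbb subr_eq0.
by move/eqP.
Qed.

Lemma quad_formD H u v : (forall j k, H j k = H k j) ->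
  quad_form H (fun j => u j + v j)
  = quad_form H u + quad_form H v + 2 * \sum_j u j * \sum_k H j k * v k.
Proof.
move=> symH; set S := \sum_j _ * _.
have SE : S = \sum_j \sum_k H j k * (u j * v k).
  by apply: eq_bigr => j _; rewrite mulr_sumr; apply: eq_bigr => k _; ring.
have SE' : S = \sum_j \sum_k H j k * (v j * u k).
  rewrite SE exchange_big; apply: eq_bigr => j _; apply: eq_bigr => k _.
  by rewrite symH; ring.
have -> : 2 * S = S + S by ring.
rewrite {1}SE SE' /quad_form -!big_split; apply: eq_bigr => j _ /=.
by rewrite -!big_split; apply: eq_bigr => k _ /=; ring.
Qed.

End QuadraticForms.

(** * Critical configurations minimize the energy in their cyclic order *)

Section Energy.
Context {R : realType} (alpha : R).
Hypothesis alpha_gt0 : 0 < alpha.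
Context {I : finType} (m : I -> R).
Hypothesis m_gt0 : forall j, 0 < m j.
Implicit Types a b : I -> R.

Definition energy a : R := quad_form (fun j k => kernel alpha (a j - a k)) m.

(** Polar angles are [2 * a j]: halving them turns chords into sines of differences, and the window
    [0, pi) keeps these differences in (-pi, pi). *)
Definition half_angles a : Prop :=
  injective a /\ forall j, 0 <= a j < pi.

(** Up to the factor -2 m_k, the sum is the partial derivative of the energy in a_k; its term j = k
    is zero. *)
Definition critical a : Prop :=
  forall k, \sum_j m j * dkernel alpha (a j - a k) = 0.

(* The first-order terms of the tangent inequalities cancel because dkernel is
   odd and a is critical. *)
Lemma energy_min a b : half_angles a -> half_angles b ->
  (forall j k, (a j < a k) = (b j < b k)) -> critical a ->
  energy a <= energy b /\
  (energy b <= energy a -> forall j k, a j - a k = b j - b k).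
Proof.
move=> [ainj ab] [binj bb] oab crit.
(* Excess of the kernel over its tangent at [a j - a k]; the common order gives both differences the
   same sign. *)
pose D j k := kernel alpha (b j - b k) - kernel alpha (a j - a k)
  - dkernel alpha (a j - a k) * ((b j - b k) - (a j - a k)).
have D_gt0 j k : a j - a k != b j - b k -> 0 < D j k.
  move=> jk; have [jk'|jk'] := eqVneq j k.
    by move: jk; rewrite jk' !subrr eqxx.
  rewrite /D -addrA -opprD subr_gt0; apply: kernel_tangent_sign_lt => //.
  - by rewrite subr_eq0 (inj_eq ainj).
  - by rewrite subr_eq0 (inj_eq binj).
  - by rewrite !subr_gt0.
  - by have := ab j; have := ab k; rewrite ltr_norml; lra.
  - by have := bb j; have := bb k; rewrite ltr_norml; lra.
have D_ge0 j k : 0 <= D j k.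
  have [e|/D_gt0/ltW//] := eqVneq (a j - a k) (b j - b k).
  by rewrite /D e; lra.
(* Half of the first-order term; exchanging j and k gives the other half. *)
pose L j k := m j * m k * (dkernel alpha (a j - a k) * (b j - a j)).
have L0 : \sum_j \sum_k L j k = 0.
  apply: big1 => j _.
  transitivity (- (m j * (b j - a j)) * \sum_k m k * dkernel alpha (a k - a j)).
    rewrite mulr_sumr; apply: eq_bigr => k _.
    by rewrite /L -(opprB (a k) (a j)) dkernelN; ring.
  by rewrite crit mulr0.
have EE : \sum_j \sum_k m j * m k * D j k = energy b - energy a.
  have -> : energy b - energy a =
     energy b - energy a - \sum_j \sum_k L j k - \sum_j \sum_k L k j.
    by rewrite (exchange_big _ _ _ _ _ (fun j k => L k j)) L0 !subr0.
  rewrite /energy /quad_form -!sumrB; apply: eq_bigr => j _.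
  rewrite -!sumrB; apply: eq_bigr => k _.
  by rewrite /D /L -(opprB (a j) (a k)) dkernelN; ring.
have mD j k : 0 <= m j * m k * D j k.
  by rewrite mulr_ge0// ltW// mulr_gt0.
split; first by rewrite -subr_ge0 -EE; apply: sumr_ge0 => j _; apply: sumr_ge0.
move=> ba j k; apply/eqP; apply/negP => /negP/D_gt0 Djk.
have : \sum_j \sum_k m j * m k * D j k = 0.
  apply/eqP; rewrite eq_le {1}EE subr_le0 ba.
  by apply: sumr_ge0 => ? _; apply: sumr_ge0.
move=> /eqP; rewrite psumr_eq0; last by move=> ? _; apply: sumr_ge0.
move=> /allP/(_ j (mem_index_enum _)) /=; rewrite psumr_eq0//.
move=> /allP/(_ k (mem_index_enum _)) /=.
by rewrite gt_eqF// mulr_gt0// mulr_gt0.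
Qed.

End Energy.

(** * Sums over the vertices of the regular polygon *)

Section CyclicSums.
Context {R : realType} (n : nat).
Hypothesis n_gt0 : (0 < n)%N.
Implicit Types (h : R -> R) (c : R).

(* Half of the angle of the i-th vertex of the regular n-gon. *)
Definition half_vertex (i : nat) : R := i%:R * pi / n%:R.

Lemma half_vertexD i j : half_vertex (i + j) = half_vertex i + half_vertex j.
Proof. by rewrite /half_vertex natrD !mulrDl. Qed.

Lemma half_vertex_n : half_vertex n = pi.
Proof. by rewrite /half_vertex mulrC mulKf// pnatr_eq0 -lt0n. Qed.

Lemma half_vertex0 : half_vertex 0 = 0.
Proof. by rewrite /half_vertex !mul0r. Qed.

Lemma half_vertex_lt i j : (half_vertex i < half_vertex j) = (i < j)%N.
Proof.
by rewrite /half_vertex ltr_pM2r ?invr_gt0 ?ltr0n// ltr_pM2r ?pi_gt0// ltr_nat.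
Qed.

Lemma half_vertex_bounds (i : 'I_n) : 0 <= half_vertex i < pi.
Proof.
rewrite -[X in _ < X]half_vertex_n half_vertex_lt ltn_ord andbT.
by rewrite /half_vertex !mulr_ge0 ?ler0n ?invr_ge0 ?ler0n ?pi_ge0.
Qed.

(** Both sides arise from one sum of n + 1 terms by removing an end term; the ends agree by
    periodicity. *)
Lemma sum_half_vertexS h c : periodic h pi ->
  \sum_(i < n) h (half_vertex i.+1 + c) = \sum_(i < n) h (half_vertex i + c).
Proof.
move=> hpi; apply: (addrI (h c)).
transitivity (\sum_(i < n.+1) h (half_vertex i + c)).
  by rewrite big_ord_recl half_vertex0 add0r.
by rewrite big_ord_recr/= half_vertex_n [pi + c]addrC hpi addrC.
Qed.

Lemma sum_half_vertexB h (k : nat) : periodic h pi ->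
  \sum_(i < n) h (half_vertex i - half_vertex k) =
  \sum_(i < n) h (half_vertex i).
Proof.
move=> hpi; elim: k => [|k <-].
  by apply: eq_bigr => i _; rewrite half_vertex0 subr0.
rewrite -sum_half_vertexS//; apply: eq_bigr => i _; congr h.
by rewrite -[i.+1]addn1 -[k.+1]addn1 !half_vertexD; ring.
Qed.

Lemma sum_half_vertex_odd h : periodic h pi -> (forall t, h (- t) = - h t) ->
  \sum_(i < n) h (half_vertex i) = 0.
Proof.
move=> hpi hodd; set S := LHS.
suff : S = - S by move=> ?; lra.
rewrite {1}/S (reindex_inj rev_ord_inj) /= -sumrN.
(* Reversal sends i to [n - i.+1], the reflection of [i.+1] rather than of i; the cyclic shift
   absorbs this offset. *)
have := sum_half_vertexS 0 (h := fun t => - h t).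
have -> : \sum_(i < n) - h (half_vertex i) = \sum_(i < n) - h (half_vertex i + 0).
  by apply: eq_bigr => i _; rewrite addr0.
move=> <-; last by move=> t; rewrite hpi.
apply: eq_bigr => i _; rewrite addr0 -hodd -(hpi (- _)) -half_vertex_n.
have -> : half_vertex n = half_vertex (n - i.+1) + half_vertex i.+1.
  by rewrite -half_vertexD subnK.
by rewrite addrC addrK.
Qed.

(** Turning by one vertex preserves the sum S; since the sine sum vanishes, S = S cos(2 pi/n), and
    this cosine is below 1. *)
Lemma sum_cos_half_vertex : (1 < n)%N ->
  \sum_(i < n) cos (2 * half_vertex i) = 0.
Proof.
move=> n1; set S := LHS.
have cpi : periodic (fun t : R => cos (2 * t)) pi.
  by move=> t; rewrite mulrDr [2 * pi]mulr_natl cosD2pi.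
have spi : periodic (fun t : R => sin (2 * t)) pi.
  by move=> t; rewrite mulrDr [2 * pi]mulr_natl sinD2pi.
have S0 : \sum_(i < n) sin (2 * half_vertex i) = 0.
  by apply: (sum_half_vertex_odd spi) => t; rewrite mulrN sinN.
have := sum_half_vertexB 1 cpi.
under eq_bigr do rewrite mulrBr cosB.
rewrite big_split/= -!mulr_suml S0 mul0r addr0 -/S => eS.
have : cos (2 * half_vertex 1) < 1.
  have v1 : 0 < half_vertex 1 by rewrite -half_vertex0 half_vertex_lt.
  have v2 : half_vertex 1 < pi by rewrite -half_vertex_n half_vertex_lt.
  rewrite mulr_natl cos_mulr2n cos2sin2.
  have : 0 < sin (half_vertex 1) ^+ 2 by rewrite exprn_gt0// sin_gt0_pi ?v1.
  lra.
have /eqP : S * (1 - cos (2 * half_vertex 1)) = 0 by lra.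
by rewrite mulf_eq0 subr_eq0 => /orP[/eqP//|/eqP <-]; rewrite ltxx.
Qed.

End CyclicSums.

(** * Effect of centering, and negativity of the kernel form *)

Section HalfAngles.
Context {R : realType} (alpha : R) {I : finType}.
Hypothesis alpha_gt0 : 0 < alpha.
Implicit Types (a : I -> R) (m v w : I -> R).

(** The hypotheses place the center of mass at the center of the circle. They make the correction
    (alpha/2) sin^2 add a constant to the radial sums. *)
Lemma sum_sin2B m a k :
  \sum_j m j * cos (2 * a j) = 0 -> \sum_j m j * sin (2 * a j) = 0 ->
  \sum_j m j * sin (a j - a k) ^+ 2 = (\sum_j m j) / 2.
Proof.
move=> mcos msin; transitivity (\sum_j (m j / 2
    - cos (2 * a k) / 2 * (m j * cos (2 * a j))
    - sin (2 * a k) / 2 * (m j * sin (2 * a j)))).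
  apply: eq_bigr => j _.
  have : cos (2 * (a j - a k)) = 1 - 2 * sin (a j - a k) ^+ 2.
    by rewrite mulr_natl cos_mulr2n cos2sin2; ring.
  rewrite mulrBr cosB => e.
  have -> : sin (a j - a k) ^+ 2 = (1 - (1 - 2 * sin (a j - a k) ^+ 2)) / 2.
    by field.
  by rewrite -e; field.
by rewrite !sumrB -!mulr_sumr mcos msin -mulr_suml; ring.
Qed.

(** The same correction adds nothing to the tangential sums. *)
Lemma sum_sin_cosB m a k :
  \sum_j m j * cos (2 * a j) = 0 -> \sum_j m j * sin (2 * a j) = 0 ->
  \sum_j m j * (sin (a j - a k) * cos (a j - a k)) = 0.
Proof.
move=> mcos msin; transitivity (\sum_j (
    cos (2 * a k) / 2 * (m j * sin (2 * a j))
    - sin (2 * a k) / 2 * (m j * cos (2 * a j)))).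
  apply: eq_bigr => j _.
  have : sin (2 * (a j - a k)) = 2 * (sin (a j - a k) * cos (a j - a k)).
    by rewrite mulr_natl sin_mulr2n; ring.
  rewrite mulrBr (sinB (2 * a j)) => e.
  have -> : sin (a j - a k) * cos (a j - a k) =
      (2 * (sin (a j - a k) * cos (a j - a k))) / 2 by field.
  by rewrite -e; field.
by rewrite sumrB -!mulr_sumr mcos msin; ring.
Qed.

(** Subtracting [rho] from all entries does not change the form on vectors of sum zero; [w] becomes
    a supersolution, and off-diagonal entries are nonnegative, zero only at differences of absolute
    value pi/2. *)
Lemma kernel_quad_form_le0 a v w : half_angles a -> (forall j, 0 < w j) ->
  (forall j, \sum_k kernel alpha (a j - a k) * w k
             <= (1 + alpha / 2) * \sum_k w k) ->
  \sum_k v k = 0 ->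
  let q := quad_form (fun j k => kernel alpha (a j - a k)) v in
  q <= 0 /\ (0 <= q -> forall j k, j != k -> `|a j - a k| != pi / 2 ->
                        v j / w j = v k / w k).
Proof.
move=> [ainj ab] w0 Hw v0; set rho := 1 + alpha / 2.
pose H j k := kernel alpha (a j - a k) - rho.
have -> : quad_form (fun j k => kernel alpha (a j - a k)) v = quad_form H v.
  apply/eqP; rewrite -subr_eq0 -sumrB big1// => j _; rewrite -sumrB.
  transitivity (rho * v j * \sum_k v k); last by rewrite v0 mulr0.
  by rewrite mulr_sumr; apply: eq_bigr => k _; rewrite /H; ring.
have jk0 j k : j != k -> a j - a k != 0 /\ `|a j - a k| < pi.
  move=> jk; rewrite subr_eq0 (inj_eq ainj); split=> //.
  by have := ab j; have := ab k; rewrite ltr_norml; lra.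
have symH j k : H j k = H k j by rewrite /H -(opprB (a k)) kernelN.
have H0 j k : j != k -> 0 <= H j k.
  by move=> /jk0[? ?]; rewrite subr_ge0 kernel_ge.
have Hw0 j : \sum_k H j k * w k <= 0.
  under eq_bigr do rewrite mulrBl.
  by rewrite sumrB -mulr_sumr subr_le0.
have [q0 qeq] := quad_form_le0 v symH H0 w0 Hw0.
split=> // /qeq vw j k jk th; apply: vw => //.
by have [? ?] := jk0 _ _ jk; rewrite subr_gt0 kernel_gt.
Qed.

End HalfAngles.

(** * The regular polygon as reference configuration *)

Section Polygon.
Context {R : realType} (alpha : R) (n : nat).
Hypothesis alpha_gt0 : 0 < alpha.
Hypothesis n_gt1 : (1 < n)%N.

Let n_gt0 : (0 < n)%N. Proof. exact: ltnW. Qed.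

Definition polygon (s : 'S_n) (k : 'I_n) : R := half_vertex n (s k).

Lemma half_angles_polygon s : half_angles (polygon s).
Proof.
split=> [j k jk|j]; last exact: half_vertex_bounds.
apply: (@perm_inj _ s); apply: ord_inj.
have := @half_vertex_lt R n n_gt0 (s j) (s k).
have := @half_vertex_lt R n n_gt0 (s k) (s j).
rewrite -/(polygon s j) -/(polygon s k) jk !ltxx.
by case: ltngtP.
Qed.

Lemma sum_polygonB (h : R -> R) s k : periodic h pi ->
  \sum_j h (polygon s j - polygon s k) = \sum_(i < n) h (half_vertex n i).
Proof.
move=> hpi; rewrite -(sum_half_vertexB n_gt0 (s k) hpi).
by rewrite [RHS](reindex_inj (@perm_inj _ s)).
Qed.

Lemma sum_polygon_odd (h : R -> R) s k : periodic h pi ->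
  (forall t, h (- t) = - h t) ->
  \sum_j h (polygon s j - polygon s k) = 0.
Proof. by move=> hpi hodd; rewrite sum_polygonB// sum_half_vertex_odd. Qed.

Lemma critical_polygon s c : critical alpha (fun=> c) (polygon s).
Proof.
move=> k; rewrite -mulr_sumr sum_polygon_odd ?mulr0//.
- by move=> t; rewrite dkernelDpi.
- by move=> t; rewrite dkernelN.
Qed.

Lemma sum_sin2_half_vertex :
  \sum_(i < n) sin (half_vertex n i : R) ^+ 2 = n%:R / 2.
Proof.
transitivity (\sum_(i < n) (2^-1 - cos (2 * (half_vertex n i : R)) / 2)).
  by apply: eq_bigr => i _; rewrite mulr_natl cos_mulr2n cos2sin2; field.
by rewrite sumrB -mulr_suml sum_cos_half_vertex// mul0r subr0 sumr_const
  card_ord mulr_natl.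
Qed.

Lemma sum_kernel_polygon s k :
  \sum_j kernel alpha (polygon s j - polygon s k)
  = \sum_(1 <= j < n) csc (j%:R * pi / n%:R) `^ alpha + n%:R * alpha / 4.
Proof.
rewrite sum_polygonB; last by move=> t; rewrite kernelDpi.
rewrite big_split/= -mulr_sumr sum_sin2_half_vertex; congr (_ + _); last by field.
rewrite -(big_mkord xpredT (fun i => `|sin (half_vertex n i)| `^ (- alpha))).
(* The term of index 0 is a negative power of zero, which is 0 by convention. *)
rewrite big_ltn// half_vertex0 sin0 normr0 powR0 ?oppr_eq0 ?gt_eqF// add0r.
apply: eq_big_nat => j /andP[j1 jn].
have sj : 0 < sin (half_vertex n j : R).
  apply: sin_gt0_pi; rewrite -{1}(half_vertex0 n) -(half_vertex_n n_gt0).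
  by rewrite !half_vertex_lt// j1.
rewrite /csc -/(half_vertex n j) gtr0_norm//.
by rewrite -[(sin _)^-1]powR_inv1 ?ltW// -powRrM mulN1r.
Qed.

(** The rank of k is the number of indices j with [a j < a k]. *)
Lemma rank_perm (a : 'I_n -> R) : injective a ->
  exists s : 'S_n, forall j k, (a j < a k) = (s j < s k)%N.
Proof.
move=> ainj; pose below k := [set j | a j < a k].
have lt_card j k : a j < a k -> (#|below j| < #|below k|)%N.
  move=> jk; apply/proper_card/properP; split.
    by apply/subsetP => i; rewrite !inE => /lt_trans; apply.
  by exists j; rewrite !inE ?ltxx.
have card_n k : (#|below k| < n)%N.
  rewrite -[X in (_ < X)%N]card_ord -cardsT; apply/proper_card/properP.
  by split; [exact: subsetT|exists k; rewrite !inE ?ltxx].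
have rinj : injective (fun k => Ordinal (card_n k)).
  move=> j k [] ejk; apply: ainj; apply/eqP; rewrite eq_le !leNgt.
  by apply/andP; split; apply/negP => /lt_card; rewrite ejk ltnn.
exists (perm rinj) => j k; rewrite !permE /=.
have [jk|kj|jk] := ltgtP (a j) (a k).
- by rewrite lt_card.
- by apply/esym/negbTE; rewrite -leqNgt ltnW// lt_card.
- by rewrite (ainj _ _ jk) ltnn.
Qed.

End Polygon.

(** * Uniqueness in terms of masses and half angles *)

Section Uniqueness.
Context {R : realType} (n : nat) (alpha : R).
Hypothesis n_ge3 : (3 <= n)%N.
Hypothesis alpha_gt0 : 0 < alpha.
Hypothesis csc_le : n%:R^-1 * \sum_(1 <= j < n) csc (j%:R * pi / n%:R) `^ alpha
                    <= 1 + alpha / 4.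

Lemma half_angles_unique (m a : 'I_n -> R) (C : R) :
  (forall k, 0 < m k) -> half_angles a ->
  \sum_j m j * cos (2 * a j) = 0 -> \sum_j m j * sin (2 * a j) = 0 ->
  (forall k, \sum_j m j * `|sin (a j - a k)| `^ (- alpha) = C) ->
  (forall k, \sum_j m j * (sin (a j - a k) * cos (a j - a k)
                            * `|sin (a j - a k)| `^ (- (alpha + 2))) = 0) ->
  (forall j k, m j = m k) /\
  exists s : 'S_n, forall j k, a j - a k = polygon s j - polygon s k.
Proof.
move=> m0 aH mcos msin mrad mtan.
have n1 : (1 < n)%N by apply: leq_trans n_ge3.
have n0 : 0 < n%:R :> R by rewrite ltr0n; apply: leq_trans n_ge3.
have [s sP] := rank_perm aH.1; pose b : 'I_n -> R := polygon s.
have bH : half_angles b by apply: half_angles_polygon.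
have ab j k : (a j < a k) = (b j < b k).
  by rewrite /b /polygon half_vertex_lt// ltnW.
pose M := \sum_j m j; pose mu := M / n%:R.
have M0 : 0 < M.
  rewrite /M (bigD1 (Ordinal n1))//= ltr_pwDl// sumr_ge0// => j _; exact: ltW.
have mu0 : 0 < mu by rewrite divr_gt0.
have ME : M = n%:R * mu by rewrite /mu mulrC divfK// gt_eqF.
pose rho := 1 + alpha / 2.
pose G (j k : 'I_n) := kernel alpha (a j - a k).
pose G' (j k : 'I_n) := kernel alpha (b j - b k).
have symG j k : G j k = G k j by rewrite /G -(opprB (a k)) kernelN.
have symG' j k : G' j k = G' k j by rewrite /G' -(opprB (b k)) kernelN.
(* The correction adds (alpha/2)(M/2) to the radial constant. *)
pose E := C + alpha * M / 4.
pose E' := \sum_(1 <= j < n) csc (j%:R * pi / n%:R) `^ alpha + n%:R * alpha / 4.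
have GE j : \sum_k G j k * m k = E.
  transitivity (\sum_k m k * `|sin (a k - a j)| `^ (- alpha)
      + alpha / 2 * \sum_k m k * sin (a k - a j) ^+ 2).
    rewrite mulr_sumr -big_split; apply: eq_bigr => k _ /=.
    by rewrite symG /G /kernel; ring.
  by rewrite mrad sum_sin2B// /E -/M; field.
have GE' j : \sum_k G' j k = E'.
  rewrite /E' -(sum_kernel_polygon alpha_gt0 n1 s j).
  by apply: eq_bigr => k _; rewrite symG'.
have E'_le : E' <= n%:R * rho.
  have : n%:R * (n%:R^-1 * \sum_(1 <= j < n) csc (j%:R * pi / n%:R) `^ alpha)
      <= n%:R * (1 + alpha / 4) by rewrite ler_pM2l.
  rewrite mulVKf ?gt_eqF// /E' /rho; lra.
have crit_a : critical alpha m a.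
  move=> k; transitivity (alpha * (\sum_j m j * (sin (a j - a k) * cos (a j - a k)))
    - alpha * \sum_j m j * (sin (a j - a k) * cos (a j - a k)
                            * `|sin (a j - a k)| `^ (- (alpha + 2)))).
    rewrite !mulr_sumr -sumrB; apply: eq_bigr => j _.
    by rewrite /dkernel; ring.
  by rewrite mtan sum_sin_cosB// !mulr0 subr0.
pose v j := m j - mu.
have v0 : \sum_j v j = 0.
  by rewrite sumrB sumr_const card_ord -/M ME mulr_natl subrr.
pose e (_ : 'I_n) : R := 1.
have mass_energy : quad_form G m = M * E.
  rewrite mulr_suml; apply: eq_bigr => j _.
  rewrite -(GE j) mulr_sumr; apply: eq_bigr => k _; ring.
have cst_energy H c : quad_form H (fun=> c) = c ^+ 2 * quad_form H e.
  rewrite /quad_form mulr_sumr; apply: eq_bigr => j _.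
  by rewrite mulr_sumr; apply: eq_bigr => k _; rewrite /e; ring.
have e_energy' : quad_form G' e = n%:R * E'.
  rewrite -[n in n%:R]card_ord mulr_natl -sumr_const; apply: eq_bigr => j _.
  by rewrite -(GE' j); apply: eq_bigr => k _; rewrite /e !mulr1.
have polygon_energy : quad_form G' m = mu * M * E' + quad_form G' v.
  have -> : quad_form G' m = quad_form G' (fun j => v j + mu).
    by apply: eq_bigr => j _; apply: eq_bigr => k _; rewrite /v !subrK.
  rewrite quad_formD// cst_energy e_energy'.
  under [X in 2 * X]eq_bigr do rewrite -mulr_suml GE'.
  by rewrite -mulr_suml v0 ME; ring.
(* The all-ones vector is the supersolution here, by [E'_le]. *)
have [G'v_le0 G'v_eq] : quad_form G' v <= 0 /\
    (0 <= quad_form G' v -> forall j k, j != k -> `|b j - b k| != pi / 2 ->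
      v j / e j = v k / e k).
  apply: kernel_quad_form_le0 => // j.
  under eq_bigr do rewrite mulr1.
  by rewrite -/G' GE' sumr_const card_ord mulrC.
have [am _] := energy_min alpha_gt0 m0 aH bH ab crit_a.
have E_le : E <= mu * E'.
  have : M * E <= mu * M * E' + 0.
    rewrite -mass_energy (le_trans am)//.
    by rewrite [energy _ _ _]polygon_energy lerD2l.
  by rewrite addr0 [mu * M]mulrC -mulrA ler_pM2l.
(* The deviation is taken as mu - m; since [G] maps [m] to the constant [E], the cross term is -2 M
   E. *)
have GvE : quad_form G (fun j => mu + - m j) = mu ^+ 2 * quad_form G e - M * E.
  rewrite quad_formD// cst_energy.
  have -> : quad_form G (fun j => - m j) = M * E.
    rewrite -mass_energy; apply: eq_bigr => j _; apply: eq_bigr => k _; ring.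
  under [X in 2 * X]eq_bigr => j _.
    under eq_bigr do rewrite mulrN.
    rewrite sumrN GE; over.
  by rewrite sumr_const card_ord -mulr_natl ME; ring.
(* Now [m] is the supersolution, because E <= mu E' <= rho M. *)
have Gv_le0 : quad_form G (fun j => mu + - m j) <= 0.
  apply: (proj1 (@kernel_quad_form_le0 _ alpha _ alpha_gt0 a _ m aH m0 _ _)).
    move=> j; rewrite -/(G j) GE (le_trans E_le)// -/M ME.
    have -> : (1 + alpha / 2) * (n%:R * mu) = mu * (n%:R * rho).
      by rewrite /rho; ring.
    by rewrite ler_pM2l.
  transitivity (- \sum_j v j); last by rewrite v0 oppr0.
  by rewrite -sumrN; apply: eq_bigr => j _; rewrite opprB.
have e_energy_le : mu * quad_form G e <= n%:R * E.
  rewrite -(ler_pM2l mu0) mulrA -expr2 mulrA [mu * _]mulrC -ME.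
  by rewrite -subr_le0 -GvE.
have n_mu_E : n%:R * E <= mu * quad_form G' e.
  by rewrite e_energy' mulrCA ler_pM2l.
have ba j k : (b j < b k) = (a j < a k) by rewrite ab.
have e0 j : 0 < e j by [].
(* The roles are exchanged: for unit masses the polygon is the critical configuration. *)
have [bm_le bm_eq] := energy_min alpha_gt0 e0 bH aH ba (critical_polygon alpha n1 s 1).
have Ge_le : quad_form G e <= quad_form G' e.
  by rewrite -(ler_pM2l mu0) (le_trans e_energy_le).
have baE := bm_eq Ge_le.
split; last by exists s => j k; rewrite -/b baE.
(* The chain of inequalities closes up and yields mu E' <= E, the reverse of [E_le]. *)
have Gv_ge0 : 0 <= quad_form G' v.
  have -> : quad_form G' v = quad_form G' m - mu * M * E'.
    by rewrite polygon_energy; ring.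
  rewrite subr_ge0 (le_trans _ am)// [energy _ _ _]mass_energy.
  rewrite [mu * M]mulrC -mulrA ler_pM2l//.
  have : n%:R * (mu * E') <= n%:R * E.
    rewrite mulrCA -e_energy'; apply: le_trans e_energy_le.
    by rewrite ler_pM2l.
  by rewrite ler_pM2l.
(* Neighbouring half angles differ by pi/n, which is below pi/2 as n >= 3, so the equality case
   links their masses. *)
have m_neighbour i (hi : (i < n)%N) (hi1 : (i.+1 < n)%N) :
    m (s^-1%g (Ordinal hi1)) = m (s^-1%g (Ordinal hi)).
  have d : b (s^-1%g (Ordinal hi1)) - b (s^-1%g (Ordinal hi)) = pi / n%:R.
    rewrite /b /polygon !permKV /= -addn1 half_vertexD addrAC subrr add0r.
    by rewrite /half_vertex mul1r.
  have := G'v_eq Gv_ge0 (s^-1%g (Ordinal hi1)) (s^-1%g (Ordinal hi)).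
  rewrite !divr1 => h; apply: (addIr (- mu)); apply: h.
    by rewrite (inj_eq (@perm_inj _ _)) -val_eqE /= gtn_eqF.
  rewrite d gtr0_norm ?divr_gt0 ?pi_gt0// lt_eqF//.
  by rewrite ltr_pM2l ?pi_gt0// ltf_pV2 ?posrE// ltr_nat.
have m_cst i (hi : (i < n)%N) :
    m (s^-1%g (Ordinal hi)) = m (s^-1%g (Ordinal (ltnW n1))).
  elim: i hi => [|i IH] hi; first by congr (m (s^-1%g _)); apply: ord_inj.
  by rewrite (m_neighbour _ (ltnW hi)) IH.
suff mE j : m j = m (s^-1%g (Ordinal (ltnW n1))) by move=> j k; rewrite !mE.
by rewrite -[j in LHS](permK s); case: (s j) => i hi; apply: m_cst.
Qed.

End Uniqueness.

(** * Orthonormal frames and polar angles *)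

Section Frames.
Context {R : realType}.
Implicit Types (a b c s t : R).

Lemma dotC d (p q : 'rV[R]_d) : dot p q = dot q p.
Proof. by apply: eq_bigr => i _; rewrite mulrC. Qed.

Lemma dot_linear_l d a b (p q w : 'rV[R]_d) :
  dot (a *: p + b *: q) w = a * dot p w + b * dot q w.
Proof.
rewrite !mulr_sumr -big_split; apply: eq_bigr => i _ /=.
by rewrite !mxE; ring.
Qed.

Lemma dot_linear_r d a b (p q w : 'rV[R]_d) :
  dot w (a *: p + b *: q) = a * dot w p + b * dot w q.
Proof. by rewrite dotC dot_linear_l !(dotC w). Qed.

Lemma dot_ge0 d (p : 'rV[R]_d) : 0 <= dot p p.
Proof. by apply: sumr_ge0 => i _; rewrite -expr2 sqr_ge0. Qed.

Lemma dot_gt0 d (p : 'rV[R]_d) : p != 0 -> 0 < dot p p.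
Proof.
move=> p0; rewrite lt_neqAle dot_ge0 andbT eq_sym; apply: contraNneq p0.
move=> /eqP; rewrite psumr_eq0; last by move=> i _; rewrite -expr2 sqr_ge0.
move=> /allP p0; apply/eqP/rowP => i; rewrite mxE; apply/eqP.
by have := p0 i (mem_index_enum _); rewrite /= mulf_eq0 orbb.
Qed.

Lemma enorm_sqr d (p : 'rV[R]_d) : enorm p ^+ 2 = dot p p.
Proof. by rewrite /enorm sqr_sqrtr ?dot_ge0. Qed.

Definition orthonormal d (u v : 'rV[R]_d) : Prop :=
  [/\ dot u u = 1, dot v v = 1 & dot u v = 0].

Lemma dot_orthonormal d (u v : 'rV[R]_d) a b a' b' : orthonormal u v ->
  dot (a *: u + b *: v) (a' *: u + b' *: v) = a * a' + b * b'.
Proof.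
move=> [uu vv uv]; rewrite !(dot_linear_l, dot_linear_r) uu vv uv.
by rewrite dotC uv; ring.
Qed.

Lemma orthonormal_inj d (u v : 'rV[R]_d) a b a' b' : orthonormal u v ->
  a *: u + b *: v = a' *: u + b' *: v -> a = a' /\ b = b'.
Proof.
move=> uv e; split.
  have := congr1 (fun p => dot p (1 *: u + 0 *: v)) e.
  by rewrite /= !dot_orthonormal// !mulr1 !mulr0 !addr0.
have := congr1 (fun p => dot p (0 *: u + 1 *: v)) e.
by rewrite /= !dot_orthonormal// !mulr1 !mulr0 !add0r.
Qed.

Lemma orthonormal_rotate d (u v : 'rV[R]_d) t : orthonormal u v ->
  orthonormal (cos t *: u + sin t *: v) (- sin t *: u + cos t *: v).
Proof.
move=> uv; have := cos2Dsin2 t.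
by split; rewrite dot_orthonormal//; lra.
Qed.

(** Index addition in ['I_3] wraps around modulo 3. *)
Definition cross (p q : 'rV[R]_3) : 'rV[R]_3 :=
  \row_i (p 0 (i + 1) * q 0 (i + 2) - p 0 (i + 2) * q 0 (i + 1)).

Lemma crossE (p q : 'rV[R]_3) :
  [/\ cross p q 0 0 = p 0 1 * q 0 2 - p 0 2 * q 0 1,
      cross p q 0 1 = p 0 2 * q 0 0 - p 0 0 * q 0 2 &
      cross p q 0 2 = p 0 0 * q 0 1 - p 0 1 * q 0 0].
Proof.
by split; rewrite mxE; congr (p 0 _ * q 0 _ - p 0 _ * q 0 _); apply: val_inj.
Qed.

Lemma orthonormal_completion (nu u : 'rV[R]_3) :
  nu != 0 -> dot u u = 1 -> dot u nu = 0 ->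
  exists2 v, orthonormal u v &
    forall p, dot p nu = 0 -> p = dot p u *: u + dot p v *: v.
Proof.
move=> nu0 uu unu; set N := enorm nu.
have N2 : N ^+ 2 = dot nu nu by rewrite enorm_sqr.
have N0 : N != 0 by rewrite -sqrf_eq0 N2 gt_eqF// dot_gt0.
pose w := N^-1 *: nu; pose v := cross w u.
have dot3 (p q : 'rV[R]_3) :
    dot p q = p 0 0 * q 0 0 + p 0 1 * q 0 1 + p 0 2 * q 0 2.
  rewrite /dot !big_ord_recl big_ord0 addr0 addrA.
  by congr (_ * _ + _ * _ + _ * _); congr (_ 0 _); apply: val_inj.
have [v0 v1 v2] := crossE w u; rewrite -/v in v0 v1 v2.
have ww : dot w w = 1.
  have -> : dot w w = N^-1 ^+ 2 * dot nu nu.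
    by rewrite !dot3 !mxE; ring.
  by rewrite -N2 exprVn mulVf// sqrf_eq0.
have pw p : dot p nu = 0 -> dot p w = 0.
  move=> pnu; have -> : dot p w = N^-1 * dot p nu by rewrite !dot3 !mxE; ring.
  by rewrite pnu mulr0.
have uw := pw u unu.
have uv : dot u v = 0 by rewrite dot3 v0 v1 v2; ring.
have wv : dot w v = 0 by rewrite dot3 v0 v1 v2; ring.
have vv : dot v v = 1.
  have -> : dot v v = dot u u * dot w w - dot u w ^+ 2.
    by rewrite !dot3 v0 v1 v2; ring.
  by rewrite uu ww uw; ring.
exists v => // p pnu.
(* The rows are orthonormal, so O O^T = 1; hence O^T O = 1, which expands [p] in the frame. *)
pose O : 'M[R]_3 := \matrix_(i, j) [:: u; v; w]`_i 0 j.
have dotE i j : (O *m O^T) i j = dot [:: u; v; w]`_i [:: u; v; w]`_j.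
  by rewrite mxE; apply: eq_bigr => k _; rewrite !mxE.
have O1 : O *m O^T = 1%:M.
  apply/matrixP => i j; rewrite dotE mxE.
  by case: i j => [[|[|[|//]]] ?] [[|[|[|//]]] ?] /=;
    rewrite ?uu ?vv ?ww ?uv ?uw ?wv ?(dotC v u) ?(dotC w u) ?(dotC v w)
      ?uv ?uw ?wv.
have {}O1 := mulmx1C O1.
rewrite -[LHS]mulmx1 -O1 mulmxA; apply/rowP => i.
have pO (k : 'I_3) : (p *m O^T) 0 k = dot p [:: u; v; w]`_k.
  by rewrite mxE; apply: eq_bigr => l _; rewrite !mxE.
rewrite mxE !big_ord_recl big_ord0 !pO !mxE /= (pw p pnu).
by ring.
Qed.

Lemma half_angle_exists c s : c ^+ 2 + s ^+ 2 = 1 ->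
  exists2 t, 0 <= t < pi & c = cos (2 * t) /\ s = sin (2 * t).
Proof.
move=> cs; have pi0 := pi_gt0 R.
have c1 : -1 <= c <= 1.
  rewrite -ler_norml -(@ler_pXn2r _ 2) ?nnegrE ?ler01// expr1n real_normK ?num_real//.
  by rewrite -cs lerDl sqr_ge0.
have ac : cos (acos c) = c by rewrite acosK.
have as_ : sin (acos c) = `|s|.
  by rewrite sin_acos// -cs addrC addKr sqrtr_sqr.
have a0 := acos_ge0 c1; have api := acos_lepi c1.
have [s0|s0] := leP 0 s.
  exists (acos c / 2); first lra.
  by rewrite mulrC divfK ?pnatr_eq0// ac as_ ger0_norm.
(* For s < 0 the polar angle is 2 pi - acos c; excluding c = 1 keeps it below 2 pi. *)
have cn1 : c != 1.
  apply: contraTneq s0 => c1'; rewrite -leNgt.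
  have : s ^+ 2 = 0 by move: cs; rewrite c1'; lra.
  by move=> /eqP; rewrite sqrf_eq0 => /eqP ->.
have ap : 0 < acos c by apply: acos_gt0; lra.
exists (pi - acos c / 2); first lra.
have -> : 2 * (pi - acos c / 2) = - acos c + pi *+ 2 by field.
by rewrite cosD2pi sinD2pi cosN sinN ac as_ ltr0_norm// opprK.
Qed.

End Frames.

(** * The equations of a central configuration on a circle *)

Section Circles.
Context {R : realType} (alpha : R) (n : nat) (m : 'I_n -> R).
Hypothesis alpha_gt0 : 0 < alpha.
Hypothesis m_gt0 : forall k, 0 < m k.
Context (x : 'I_n -> 'rV[R]_3) (c u v : 'rV[R]_3) (r : R) (a : 'I_n -> R).
Hypothesis r_gt0 : 0 < r.
Hypothesis uv : orthonormal u v.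
Hypothesis xE : forall k, x k = c + r *: (cos (2 * a k) *: u + sin (2 * a k) *: v).

Let radial k := cos (2 * a k) *: u + sin (2 * a k) *: v.
Let tangential k := - sin (2 * a k) *: u + cos (2 * a k) *: v.

Let radial_tangential k : orthonormal (radial k) (tangential k).
Proof. exact: orthonormal_rotate. Qed.

(** The chord is resolved in the radial and tangential frame at [x k] by double-angle formulas. *)
Lemma circle_sub j k : x j - x k =
  (- (2 * r * sin (a j - a k) ^+ 2)) *: radial k
  + (2 * r * (sin (a j - a k) * cos (a j - a k))) *: tangential k.
Proof.
have -> : x j - x k =
    r *: ((cos (2 * a j) - cos (2 * a k)) *: u
          + (sin (2 * a j) - sin (2 * a k)) *: v).
  by apply/rowP => i; rewrite !xE !mxE; ring.
have -> : 2 * a j = 2 * (a j - a k) + 2 * a k by ring.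
rewrite (cosD (2 * _)) (sinD (2 * _)).
have -> : cos (2 * (a j - a k)) = 1 - 2 * sin (a j - a k) ^+ 2.
  by rewrite mulr_natl cos_mulr2n cos2sin2; ring.
have -> : sin (2 * (a j - a k)) = 2 * (sin (a j - a k) * cos (a j - a k)).
  by rewrite mulr_natl sin_mulr2n; ring.
by apply/rowP => i; rewrite /radial /tangential !mxE; ring.
Qed.

Lemma enorm_circle j k : enorm (x j - x k) = 2 * r * `|sin (a j - a k)|.
Proof.
rewrite /enorm circle_sub dot_orthonormal//.
set S := sin _; set K := cos _.
have -> : - (2 * r * S ^+ 2) * - (2 * r * S ^+ 2) +
    2 * r * (S * K) * (2 * r * (S * K)) = (2 * r * S) ^+ 2 * (K ^+ 2 + S ^+ 2).
  by ring.
by rewrite cos2Dsin2 mulr1 sqrtr_sqr normrM gtr0_norm// mulr_gt0.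
Qed.

Let kappa : R := 2 * r / (2 * r) `^ (alpha + 2).

Let kappa_gt0 : 0 < kappa.
Proof. by rewrite divr_gt0 ?powR_gt0// mulr_gt0. Qed.

Lemma force_circle j k :
  (enorm (x j - x k) `^ (alpha + 2))^-1 *: (x j - x k) =
  (- (kappa * `|sin (a j - a k)| `^ (- alpha))) *: radial k
  + (kappa * (sin (a j - a k) * cos (a j - a k)
              * `|sin (a j - a k)| `^ (- (alpha + 2)))) *: tangential k.
Proof.
have r2 : 0 <= 2 * r by rewrite mulr_ge0// ltW.
rewrite enorm_circle circle_sub powRM// invfM -!powRN scalerDr !scalerA.
set S := sin _; set K := cos _.
(* This holds at S = 0 too, where both sides are 0 by convention. *)
have -> : `|S| `^ (- alpha) = S ^+ 2 * `|S| `^ (- (alpha + 2)).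
  have [->|S0] := eqVneq S 0.
    by rewrite normr0 expr0n mul0r powR0// oppr_eq0 gt_eqF.
  have -> : - alpha = 2 - (alpha + 2) by ring.
  rewrite powRD ?normr_eq0 ?S0 ?implybT// powR_mulrn// -normrX.
  by rewrite ger0_norm// sqr_ge0.
by rewrite /kappa -powRN; congr (_ *: _ + _ *: _); ring.
Qed.

(** In the frame at [x k] the right-hand side is purely radial: the tangential force must vanish,
    and the radial equation ties C to lambda. *)
Lemma central_configuration_circle : center_of_mass m x = c ->
  central_configuration alpha m x <->
  exists C : R, forall k,
    \sum_j m j * `|sin (a j - a k)| `^ (- alpha) = C /\
    \sum_j m j * (sin (a j - a k) * cos (a j - a k)
                  * `|sin (a j - a k)| `^ (- (alpha + 2))) = 0.
Proof.
move=> xc; rewrite /central_configuration xc.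
pose rad k := \sum_j m j * `|sin (a j - a k)| `^ (- alpha).
pose tan k := \sum_j m j * (sin (a j - a k) * cos (a j - a k)
                            * `|sin (a j - a k)| `^ (- (alpha + 2))).
have force k : \sum_(j < n | j != k) (m j * m k) *:
    ((enorm (x j - x k) `^ (alpha + 2))^-1 *: (x j - x k)) =
    (- (m k * kappa * rad k)) *: radial k
    + (m k * kappa * tan k) *: tangential k.
  transitivity (\sum_j (m j * m k) *:
      ((enorm (x j - x k) `^ (alpha + 2))^-1 *: (x j - x k))).
    by rewrite [RHS](bigD1 k)//= subrr !scaler0 add0r.
  rewrite !mulr_sumr -sumrN !scaler_suml -big_split; apply: eq_bigr => j _ /=.
  by rewrite force_circle; apply/rowP => i; rewrite !mxE; ring.
have restoring t k : t *: (m k *: (x k - c)) =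
    (t * m k * r) *: radial k + 0 *: tangential k.
  by rewrite xE [c + _]addrC addrK scale0r addr0 -/(radial k) !scalerA.
have mk k : m k * kappa != 0 by rewrite mulf_neq0 ?gt_eqF.
split=> [[lambda cc]|[C eqs]].
  exists (lambda / alpha * r / kappa) => k.
  have := cc k; rewrite force restoring.
  move=> /(orthonormal_inj (radial_tangential k))[radE tanE].
  split; last by apply: (mulfI (mk k)); rewrite mulr0.
  apply: (mulfI (mk k)); apply: oppr_inj; rewrite radE.
  by field; rewrite !gt_eqF.
exists (alpha * (kappa * C / r)) => k; have [radE tanE] := eqs k.
rewrite force /rad /tan radE tanE restoring mulr0.
by congr (_ *: _ + _); field; rewrite !gt_eqF.
Qed.

Lemma center_of_mass_circle : (0 < n)%N ->
  center_of_mass m x = c <->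
  \sum_j m j * cos (2 * a j) = 0 /\ \sum_j m j * sin (2 * a j) = 0.
Proof.
move=> n0; set mcos := \sum_j _; set msin := \sum_j m j * sin _.
have M0 : \sum_j m j != 0.
  rewrite gt_eqF// (bigD1 (Ordinal n0))//= ltr_pwDl// sumr_ge0// => j _.
  exact: ltW.
have -> : center_of_mass m x = c
    + ((\sum_j m j)^-1 * r * mcos *: u + (\sum_j m j)^-1 * r * msin *: v).
  rewrite /center_of_mass.
  have -> : \sum_j m j *: x j =
      (\sum_j m j) *: c + ((r * mcos) *: u + (r * msin) *: v).
    rewrite !mulr_sumr !scaler_suml -!big_split; apply: eq_bigr => j _ /=.
    by rewrite xE; apply/rowP => i; rewrite !mxE; ring.
  by rewrite !scalerDr !scalerA mulVf// scale1r !mulrA.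
have Mr : (\sum_j m j)^-1 * r != 0 by rewrite mulf_neq0 ?invr_eq0 ?(gt_eqF r_gt0).
split=> [|[-> ->]]; last by rewrite !mulr0 !scale0r !addr0.
rewrite -[RHS]addr0 => /addrI.
have -> : 0 = 0 *: u + 0 *: v :> 'rV[R]_3 by rewrite !scale0r addr0.
move=> /(orthonormal_inj uv)[mc ms].
by split; apply: (mulfI Mr); rewrite mulr0.
Qed.

End Circles.

(** * From points in space to half angles, and the equivalence *)

Lemma centered_cocircular_half_angles (R : realType) (n : nat) (m : 'I_n -> R)
    (x : 'I_n -> 'rV[R]_3) :
  (0 < n)%N -> injective x -> centered_cocircular m x ->
  exists (u v : 'rV[R]_3) (r : R) (a : 'I_n -> R),
    [/\ orthonormal u v, 0 < r, half_angles a &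
     forall k, x k = center_of_mass m x
                     + r *: (cos (2 * a k) *: u + sin (2 * a k) *: v)].
Proof.
move=> n0 xinj [nu [r [nu0 r0 circ]]]; set c := center_of_mass m x in circ *.
have sqr_radius k : dot (x k - c) (x k - c) = r ^+ 2.
  by rewrite -enorm_sqr; have [-> _] := circ k.
pose u := r^-1 *: (x (Ordinal n0) - c).
have uE p : dot u p = r^-1 * dot (x (Ordinal n0) - c) p.
  by rewrite mulr_sumr; apply: eq_bigr => i _; rewrite mxE mulrA.
have uu : dot u u = 1.
  by rewrite uE dotC uE sqr_radius; field; rewrite gt_eqF.
have unu : dot u nu = 0 by rewrite uE (proj2 (circ _)) mulr0.
have [v uv spanE] := orthonormal_completion nu0 uu unu.
have [a aP] : exists a : 'I_n -> R, forall k, 0 <= a k < pi /\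
    x k - c = r *: (cos (2 * a k) *: u + sin (2 * a k) *: v).
  apply: (fin_all_exists (P := fun k t => 0 <= t < pi /\
    x k - c = r *: (cos (2 * t) *: u + sin (2 * t) *: v))) => k.
  have xkE := spanE _ (proj2 (circ k)).
  have := sqr_radius k; rewrite {1 2}xkE dot_orthonormal//.
  set A := dot _ u in xkE *; set B := dot _ v in xkE * => AB.
  have [|t tpi [At Bt]] := @half_angle_exists R (A / r) (B / r).
    by rewrite !expr_div_n -mulrDl !expr2 AB -expr2 divff// sqrf_eq0 gt_eqF.
  exists t; split=> //; rewrite xkE -At -Bt scalerDr !scalerA.
  by congr (_ *: _ + _ *: _); field; rewrite gt_eqF.
exists u, v, r, a; split=> //.
  split=> [j k ajk|j]; last by case: (aP j).
  by apply: xinj; apply: (addIr (- c)); rewrite !(proj2 (aP _)) ajk.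
by move=> k; rewrite -(proj2 (aP k)) addrC subrK.
Qed.

Theorem theorem1p1 (R : realType) (n : nat) (alpha : R)
    (n_ge3 : (3 <= n)%N) (alpha_gt0 : 0 < alpha)
    (csc_le : n%:R^-1 * \sum_(1 <= j < n) csc (j%:R * pi / n%:R) `^ alpha
              <= 1 + alpha / 4)
    (m : 'I_n -> R) (x : 'I_n -> 'rV[R]_3)
    (m_gt0 : forall k, 0 < m k) (x_inj : injective x)
    (x_circ : centered_cocircular m x) :
  central_configuration alpha m x <->
  (forall j k : 'I_n, m j = m k) /\ regular_polygon x.
Proof.
have n_gt1 : (1 < n)%N by apply: leq_trans n_ge3.
have n_gt0 : (0 < n)%N by apply: ltnW.
pose k0 := Ordinal n_gt0.
have double_polygon (s : 'S_n) k :
    2 * polygon s k = 2 * pi * (s k)%:R / n%:R :> R.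
  by rewrite /polygon /half_vertex; ring.
split=> [cc|[m_const [c [u [v [r [s [r0 uu vv uv0 xE]]]]]]]].
  have [u [v [r [a [uv r0 aH xE]]]]] :=
    centered_cocircular_half_angles n_gt0 x_inj x_circ.
  have [/(_ erefl)[mcos msin] _] := center_of_mass_circle m_gt0 r0 uv xE n_gt0.
  have /(_ erefl)[/(_ cc)[C eqs] _] :=
    central_configuration_circle alpha_gt0 m_gt0 r0 uv xE.
  have [m_const [s sP]] := half_angles_unique n_ge3 alpha_gt0 csc_le m_gt0 aH
    mcos msin (fun k => proj1 (eqs k)) (fun k => proj2 (eqs k)).
  (* Half angles match the polygon up to a common shift; its double is the phase by which the frame
     is rotated. *)
  split=> //; pose d := 2 * (a k0 - polygon s k0).
  have [uu' vv' uv'] := orthonormal_rotate d uv.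
  exists (center_of_mass m x), (cos d *: u + sin d *: v),
    (- sin d *: u + cos d *: v), r, s; split=> // k.
  rewrite /= -double_polygon [LHS]xE; congr (_ + r *: _).
  have -> : 2 * a k = d + 2 * polygon s k.
    have := sP k k0; rewrite /d; lra.
  by rewrite cosD sinD; apply/rowP => i; rewrite !mxE; ring.
have uv : orthonormal u v by [].
have {}xE k : x k = c + r *:
    (cos (2 * polygon s k) *: u + sin (2 * polygon s k) *: v).
  by rewrite double_polygon xE.
have mE k : m k = m k0 by [].
have spi : periodic (fun t : R => sin (2 * t)) pi.
  by move=> t; rewrite mulrDr [2 * pi]mulr_natl sinD2pi.
have pE (h : R -> R) :
    \sum_j m j * h (polygon s j) = m k0 * \sum_(i < n) h (half_vertex n i).
  rewrite [in RHS](reindex_inj (@perm_inj _ s)) mulr_sumr.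
  by apply: eq_bigr => j _; rewrite mE.
(* The center of the given polygon is identified with the center of mass through the equality of
   masses. *)
have xc : center_of_mass m x = c.
  apply/(center_of_mass_circle m_gt0 r0 uv xE n_gt0); split.
    by rewrite (pE (fun t => cos (2 * t)))// sum_cos_half_vertex// mulr0.
  rewrite (pE (fun t => sin (2 * t))) (sum_half_vertex_odd n_gt0 spi) ?mulr0//.
  by move=> t; rewrite mulrN sinN.
apply/(central_configuration_circle alpha_gt0 m_gt0 r0 uv xE xc).
exists (m k0 * \sum_(i < n) `|sin (half_vertex n i)| `^ (- alpha)) => k.
split.
  under eq_bigr do rewrite mE.
  rewrite -mulr_sumr; congr (_ * _).
  apply: (sum_polygonB n_gt1 s k (h := fun t => `|sin t| `^ (- alpha))).
  by move=> t; rewrite sinDpi normrN.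
under eq_bigr do rewrite mE.
rewrite -mulr_sumr (sum_polygon_odd n_gt1 s k
  (h := fun t => sin t * cos t * `|sin t| `^ (- (alpha + 2)))) ?mulr0//.
  by move=> t; rewrite sinDpi cosDpi normrN mulrNN.
by move=> t; rewrite sinN cosN normrN !mulNr.
Qed.
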